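(* Let $X$ be a real tree such that every geodesic of $X$ can be extended, and suppose that $X$ is an asymptotic cone (that is, $X$ is isometric to $C(Y,q,\nu)$ for some metric space $Y$, some $q\in{}^*Y$ and some $\nu\in{}^*\mathbb{R}$ with $\nu\gg1$). If $p\in X$ and the valency of $X$ at $p$ is infinite, then this valency is at least $2^{\aleph_0}$.
   Context: Nonstandard extensions. Fix a non-principal ultrafilter $\mathcal{U}$ on $\mathbb{N}$. For a set $X$, ${}^*X$ is the ultrapower $X^{\mathbb{N}}/\mathcal{U}$ (functions identified if they agree on a set in $\mathcal{U}$), with $X\subseteq{}^*X$ via constant functions; functions and relations (in particular the order and operations of $\mathbb{R}$ and the metric $d$ of a metric space, giving $d:{}^*X\times{}^*X\to{}^*\mathbb{R}$) are extended componentwise modulo $\mathcal{U}$. For $\xi,\eta\in{}^*\mathbb{R}$, $\eta\neq 0$: $\xi\in o(\eta)$ means $\xi/\eta$ is infinitesimal; $\xi\in O(\eta)$ means $\xi/\eta$ is finite, i.e. bounded in absolute value by a standard real; $\xi\gg\eta$ means $\xi,\eta$ are nonnegative and $\xi/\eta$ is infinite. For finite $\xi\in{}^*\mathbb{R}$, $st(\xi)$ is the unique real with $\xi-st(\xi)$ infinitesimal. Asymptotic cones. Let $(Y,d)$ be a metric space, $q\in{}^*Y$ (basepoint) and $\nu\in{}^*\mathbb{R}$, $\nu\gg 1$ (scaling factor). On ${}^*Y$ put $x\sim y\iff d(x,y)\in o(\nu)$. The asymptotic cone is $C(Y,q,\nu)=\{[x]\in{}^*Y/{\sim}\,:\, d(x,q)\in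 O(\nu)\}$ with metric $d([x],[y])=st(d(x,y)/\nu)$. Real trees. A geodesic in a metric space $X$ is a map $\gamma:[0,l]\to X$ with $d(\gamma(t),\gamma(s))=|t-s|$ for all $t,s$; $X$ is geodesic if any two points are joined by a geodesic. A real tree is a complete geodesic metric space in which every geodesic triangle is a tripod, i.e. each side is contained in the union of the other two. ''Every geodesic can be extended'' means that every geodesic $\gamma:[0,l]\to X$ with $l>0$ is the restriction to $[0,l]$ of a geodesic $[0,l']\to X$ with $l'>l$. The valency of a real tree $T$ at $p\in T$ is the number (cardinality of the set) of connected components of $T\setminus\{p\}$. *)

(* Defs.v *)
From HB Require Import structures.
From mathcomp Require Import all_boot all_order all_algebra.
From mathcomp Require Import generic_quotient.
From mathcomp Require Import all_classical all_reals all_analysis.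
From mathcomp Require Import ring lra.

Set Implicit Arguments.
Unset Strict Implicit.
Unset Printing Implicit Defensive.

Import Order.TTheory GRing.Theory Num.Theory.
Import numFieldNormedType.Exports.
Local Open Scope classical_set_scope.
Local Open Scope ring_scope.
Local Open Scope quotient_scope.

Section Ultrapower.
Context (U : set_system nat) {UU : UltraFilter U}.
Implicit Types T : choiceType.

Definition ultra_eq (T : choiceType) : rel (nat -> T) :=
  fun u v => `[< \forall n \near U, u n = v n >].

Lemma ultra_eq_refl T : reflexive (@ultra_eq T).
Proof. by move=> u; apply/asboolP; near=> n. Unshelve. all: by end_near. Qed.

Lemma ultra_eq_sym T : symmetric (@ultra_eq T).
Proof.
by move=> u v; apply/asboolP/asboolP; apply: filterS => n ->.
Qed.

Lemma ultra_eq_trans T : transitive (@ultra_eq T).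
Proof.
move=> v u w /asboolP uv /asboolP vw; apply/asboolP.
by apply: filterS2 uv vw => n -> ->.
Qed.

Definition ultra_equiv (T : choiceType) : equiv_rel (nat -> T) :=
  EquivRel (@ultra_eq T) (@ultra_eq_refl T) (@ultra_eq_sym T)
    (@ultra_eq_trans T).

Definition ultrapower (T : choiceType) : Type := {eq_quot (ultra_equiv T)}.

HB.instance Definition _ T := Choice.on (ultrapower T).
HB.instance Definition _ T := EqQuotient.on (ultrapower T).

Definition ultra_class T (u : nat -> T) : ultrapower T := \pi u.

Definition ultra_cst T (x : T) : ultrapower T := ultra_class (fun=> x).

Definition ultra_map (T1 T2 : choiceType) (f : T1 -> T2) (x : ultrapower T1) :
    ultrapower T2 :=
  ultra_class (fun n => f (repr x n)).

Definition ultra_map2 (T1 T2 T3 : choiceType) (f : T1 -> T2 -> T3)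
    (x : ultrapower T1) (y : ultrapower T2) : ultrapower T3 :=
  ultra_class (fun n => f (repr x n) (repr y n)).

Definition ultra_rel (T1 T2 : choiceType) (r : T1 -> T2 -> Prop)
    (x : ultrapower T1) (y : ultrapower T2) : Prop :=
  \forall n \near U, r (repr x n) (repr y n).

Lemma ultra_classP T (u v : nat -> T) :
  ultra_class u = ultra_class v <-> \forall n \near U, u n = v n.
Proof.
split=> [/eqmodP/asboolP//|uv].
by apply/eqmodP/asboolP.
Qed.

Lemma ultra_reprK T (x : ultrapower T) : ultra_class (repr x) = x.
Proof. exact: reprK. Qed.

Lemma repr_ultra_class T (u : nat -> T) :
  \forall n \near U, repr (ultra_class u) n = u n.
Proof. by apply/ultra_classP; exact: ultra_reprK. Qed.

Lemma ultra_mapE (T1 T2 : choiceType) (f : T1 -> T2) (u : nat -> T1) :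
  ultra_map f (ultra_class u) = ultra_class (fun n => f (u n)).
Proof.
by apply/ultra_classP; apply: filterS (repr_ultra_class u) => n ->.
Qed.

Lemma ultra_map2E (T1 T2 T3 : choiceType) (f : T1 -> T2 -> T3)
    (u : nat -> T1) (v : nat -> T2) :
  ultra_map2 f (ultra_class u) (ultra_class v) =
  ultra_class (fun n => f (u n) (v n)).
Proof.
apply/ultra_classP.
by apply: filterS2 (repr_ultra_class u) (repr_ultra_class v) => n -> ->.
Qed.

Lemma ultra_relE (T1 T2 : choiceType) (r : T1 -> T2 -> Prop)
    (u : nat -> T1) (v : nat -> T2) :
  ultra_rel r (ultra_class u) (ultra_class v) <->
  \forall n \near U, r (u n) (v n).
Proof.
split; apply: filterS3 (repr_ultra_class u) (repr_ultra_class v) => n;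
  by move=> -> ->.
Qed.

Section Hyperreals.
Context {R : realType}.
Implicit Types xi eta : ultrapower R.

Definition hyper_le xi eta := ultra_rel (fun a b : R => a <= b) xi eta.
Definition hyper_lt xi eta := ultra_rel (fun a b : R => a < b) xi eta.
Definition hyper_abs xi := ultra_map (fun a : R => `|a|) xi.
Definition hyper_sub xi eta := ultra_map2 (fun a b : R => a - b) xi eta.
Definition hyper_div xi eta := ultra_map2 (fun a b : R => a / b) xi eta.

Definition infinitesimal xi :=
  forall e : R, 0 < e -> hyper_lt (hyper_abs xi) (ultra_cst e).

Definition hyper_finite xi :=
  exists r : R, hyper_le (hyper_abs xi) (ultra_cst r).

Definition hyper_infinite xi := ~ hyper_finite xi.

(* The three comparisons below are only meaningful for eta <> 0. *)
Definition hyper_littleo xi eta := infinitesimal (hyper_div xi eta).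
Definition hyper_bigO xi eta := hyper_finite (hyper_div xi eta).
Definition hyper_gg xi eta :=
  [/\ hyper_le (ultra_cst 0) xi, hyper_le (ultra_cst 0) eta &
      hyper_infinite (hyper_div xi eta)].

(* [st xi] is junk (equal to 0) if [xi] is not finite. *)
Definition st xi : R :=
  xget 0 [set r : R | infinitesimal (hyper_sub xi (ultra_cst r))].

Lemma infinitesimalE (u : nat -> R) :
  infinitesimal (ultra_class u) <->
  forall e : R, 0 < e -> \forall n \near U, `|u n| < e.
Proof.
rewrite /infinitesimal /hyper_lt /hyper_abs ultra_mapE.
by split=> h e /h; [move/ultra_relE|move=> {}h; apply/ultra_relE].
Qed.

Lemma hyper_finiteE (u : nat -> R) :
  hyper_finite (ultra_class u) <->
  exists r : R, \forall n \near U, `|u n| <= r.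
Proof.
rewrite /hyper_finite /hyper_le /hyper_abs ultra_mapE.
by split=> -[r h]; exists r; [move/ultra_relE : h|apply/ultra_relE].
Qed.

Lemma st_subproof (u : nat -> R) (r : R) :
  infinitesimal (hyper_sub (ultra_class u) (ultra_cst r)) <->
  forall e : R, 0 < e -> \forall n \near U, `|u n - r| < e.
Proof. by rewrite /hyper_sub ultra_map2E infinitesimalE. Qed.

Lemma st_unique xi (r : R) :
  infinitesimal (hyper_sub xi (ultra_cst r)) -> st xi = r.
Proof.
rewrite -(ultra_reprK xi); set u := repr xi => ur.
apply: xget_unique => //= s us.
move: ur us => /st_subproof ur /st_subproof us.
apply/eqP; rewrite -subr_eq0 -normr_le0; apply/ler_addgt0Pl => e e0.
have e20 : 0 < e / 2 by rewrite divr_gt0.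
have [n [/= a b]] : exists n, `|u n - r| < e / 2 /\ `|u n - s| < e / 2.
  by apply: (@filter_ex _ U); apply: filterI; [exact: ur|exact: us].
rewrite addr0 (le_trans (ler_distD (u n) _ _))// [e]splitr lerD//; last exact: ltW.
by rewrite distrC ltW.
Qed.

Lemma stP xi : hyper_finite xi ->
  infinitesimal (hyper_sub xi (ultra_cst (st xi))).
Proof.
move=> fxi; suff [r xr] : exists r : R, infinitesimal (hyper_sub xi (ultra_cst r)).
  by rewrite (st_unique xr).
move: fxi; rewrite -(ultra_reprK xi); set u := repr xi.
move=> /hyper_finiteE[M uM].
have [|p [_ pcl]] := @segment_compact R (- M) M (u @ U) _.
  by apply: filterS uM => n; rewrite /= in_itv/= ler_norml.
exists p; apply/st_subproof => e e0.
have [//|far] := in_ultra_setVsetC [set n | `|u n - p| < e] _.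
have [_ [[n nfar <-]]] := pcl (u @` [set n | ~ `|u n - p| < e]) (ball p e)
  (filterS (fun n h => ex_intro2 _ _ n h erefl) far) (nbhsx_ballx p e e0).
by rewrite /ball/= distrC.
Qed.

End Hyperreals.

Section AsymptoticCone.
Context {R : realType} {Y : metricType R} (q : ultrapower Y)
  (nu : ultrapower R).

Definition ultra_dist : ultrapower Y -> ultrapower Y -> ultrapower R :=
  ultra_map2 (@mdist R Y).

Definition cone_eq : rel (ultrapower Y) :=
  fun x y => `[< hyper_littleo (ultra_dist x y) nu >].

Lemma cone_eqE (u v : nat -> Y) (w : nat -> R) : nu = ultra_class w ->
  cone_eq (ultra_class u) (ultra_class v) <->
  forall e : R, 0 < e -> \forall n \near U, `|mdist (u n) (v n) / w n| < e.
Proof.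
rewrite /cone_eq /hyper_littleo /ultra_dist /hyper_div => ->.
by rewrite !ultra_map2E -infinitesimalE; split=> /asboolP.
Qed.

Lemma cone_eq_refl : reflexive cone_eq.
Proof.
move=> x; rewrite -(ultra_reprK x).
apply/(cone_eqE _ _ (esym (ultra_reprK nu))) => e e0.
by near=> n; rewrite mdistxx mul0r normr0.
Unshelve. all: by end_near. Qed.

Lemma cone_eq_sym : symmetric cone_eq.
Proof.
move=> x y; apply/asboolP/asboolP; rewrite /hyper_littleo /ultra_dist /ultra_map2;
  by under [fun n => mdist _ _]funext do rewrite metric_sym.
Qed.

Lemma cone_eq_trans : transitive cone_eq.
Proof.
move=> y x z; rewrite -(ultra_reprK x) -(ultra_reprK y) -(ultra_reprK z).
move=> /(cone_eqE _ _ (esym (ultra_reprK nu))) xy.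
move=> /(cone_eqE _ _ (esym (ultra_reprK nu))) yz.
apply/(cone_eqE _ _ (esym (ultra_reprK nu))) => e e0.
have e20 : 0 < e / 2 by rewrite divr_gt0.
apply: filterS2 (xy _ e20) (yz _ e20) => n.
rewrite !normrM !(ger0_norm (mdist_ge0 _ _)) => a b.
rewrite (le_lt_trans (ler_wpM2r _ (metric_triangle _ (repr y n) _)))//.
by rewrite mulrDl [e]splitr ltrD.
Qed.

Definition cone_equiv : equiv_rel (ultrapower Y) :=
  EquivRel cone_eq cone_eq_refl cone_eq_sym cone_eq_trans.

Definition cone_quotient : Type := {eq_quot cone_equiv}.

HB.instance Definition _ := Choice.on cone_quotient.
HB.instance Definition _ := EqQuotient.on cone_quotient.

Definition cone_class (x : ultrapower Y) : cone_quotient := \pi x.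

Lemma cone_classP x y : cone_class x = cone_class y <-> cone_eq x y.
Proof.
by split=> [/eqmodP//|xy]; apply/eqmodP.
Qed.

(* The unused proof that [nu] is infinite is a parameter of the type because
   the formula for the distance is a metric only under this hypothesis. *)
Definition asymptotic_cone
    (nu_gg1 : hyper_gg nu (ultra_cst 1)) : Type :=
  {c : cone_quotient |
    `[< exists2 x, c = cone_class x & hyper_bigO (ultra_dist x q) nu >]}.

Context (nu_gg1 : hyper_gg nu (ultra_cst 1)).

HB.instance Definition _ := Choice.on (asymptotic_cone nu_gg1).

Definition cone_dist (a b : asymptotic_cone nu_gg1) : R :=
  st (hyper_div (ultra_dist (repr (val a)) (repr (val b))) nu).

Let w := repr nu.

Lemma scaling_pos : \forall n \near U, 0 < w n.
Proof.
have [nu0 _ nuoo] := nu_gg1.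
have {}nu0 : \forall n \near U, 0 <= w n.
  by move: nu0; rewrite -(ultra_reprK nu) => /ultra_relE.
have [w0|w0] := in_ultra_setVsetC [set n | w n = 0] UU; last first.
  apply: filterS2 nu0 w0 => n /= ? ?.
  by rewrite lt_def; apply/andP; split => //; apply/eqP.
exfalso; apply: nuoo; rewrite -(ultra_reprK nu) /hyper_div ultra_map2E.
apply/hyper_finiteE; exists 0.
by apply: filterS w0 => n; rewrite /w /= => ->; rewrite mul0r normr0.
Qed.

Let bnd (u v : nat -> Y) :=
  exists r : R, \forall n \near U, mdist (u n) (v n) / w n <= r.

Let bndP u v :
  hyper_bigO (ultra_dist (ultra_class u) (ultra_class v)) nu <-> bnd u v.
Proof.
rewrite -(ultra_reprK nu) /hyper_bigO /ultra_dist /hyper_div !ultra_map2E.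
rewrite hyper_finiteE; split=> -[r h]; exists r;
  apply: filterS2 scaling_pos h => n w0;
  by rewrite ger0_norm// divr_ge0 ?mdist_ge0// ltW.
Qed.

Let bnd_trans u v t : bnd u v -> bnd v t -> bnd u t.
Proof.
move=> [r1 h1] [r2 h2]; exists (r1 + r2).
apply: filterS3 scaling_pos h1 h2 => n w0 h1 h2.
rewrite (le_trans _ (lerD h1 h2))// -mulrDl ler_wpM2r ?invr_ge0 ?(ltW w0)//.
exact: metric_triangle.
Qed.

Let bnd_sym u v : bnd u v -> bnd v u.
Proof. by move=> [r h]; exists r; apply: filterS h => n; rewrite metric_sym. Qed.

Let bnd_eq u v : cone_eq (ultra_class u) (ultra_class v) -> bnd u v.
Proof.
move=> /(cone_eqE _ _ (esym (ultra_reprK nu))) /(_ 1 ltr01) h.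
by exists 1; apply: filterS h => n /ltW; apply: le_trans; exact: ler_norm.
Qed.

Let rp (a : asymptotic_cone nu_gg1) : nat -> Y := repr (repr (val a)).

Let cone_finite (a b : asymptotic_cone nu_gg1) (u v : nat -> Y) :
  val a = cone_class (ultra_class u) -> val b = cone_class (ultra_class v) ->
  bnd u v.
Proof.
suff key (c : asymptotic_cone nu_gg1) t : val c = cone_class (ultra_class t) ->
    bnd t (repr q).
  by move=> /key aq /key bq; exact/(bnd_trans aq)/bnd_sym.
move=> ct; have /asboolP[x cx xq] := valP c.
have : cone_eq (ultra_class t) (ultra_class (repr x)).
  by apply/cone_classP; rewrite ultra_reprK -ct cx.
move=> /bnd_eq/bnd_trans; apply; apply/bndP.
by rewrite !ultra_reprK.
Qed.

Let reprE (a : asymptotic_cone nu_gg1) :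
  val a = cone_class (ultra_class (rp a)).
Proof. by rewrite /rp ultra_reprK [RHS]reprK. Qed.

Let stdist (u v : nat -> Y) (r : R) :=
  forall e : R, 0 < e -> \forall n \near U, `|mdist (u n) (v n) / w n - r| < e.

Let stdist_st u v r : stdist u v r ->
  st (hyper_div (ultra_dist (ultra_class u) (ultra_class v)) nu) = r.
Proof.
move=> uv; apply: st_unique.
rewrite -(ultra_reprK nu) /ultra_dist /hyper_div !ultra_map2E.
exact/st_subproof.
Qed.

Let stdistP u v : bnd u v ->
  stdist u v (st (hyper_div (ultra_dist (ultra_class u) (ultra_class v)) nu)).
Proof.
move=> /bndP/stP; set r := st _.
rewrite -(ultra_reprK nu) /ultra_dist /hyper_div !ultra_map2E.
by move/st_subproof.
Qed.

Let cone_distP a b : stdist (rp a) (rp b) (cone_dist a b).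
Proof.
rewrite /cone_dist -[repr (val a)]ultra_reprK -[repr (val b)]ultra_reprK.
apply: stdistP; exact: (cone_finite (reprE a) (reprE b)).
Qed.

Lemma cone_distE (a b : asymptotic_cone nu_gg1) x y :
  val a = cone_class x -> val b = cone_class y ->
  cone_dist a b = st (hyper_div (ultra_dist x y) nu).
Proof.
move=> ax by_; rewrite -(ultra_reprK x) -(ultra_reprK y).
apply/esym/stdist_st => e e0.
have e30 : 0 < e / 3 by rewrite divr_gt0.
have eqv (c : asymptotic_cone nu_gg1) z : val c = cone_class z ->
    \forall n \near U, mdist (repr z n) (rp c n) / w n < e / 3.
  move=> cz; have : cone_eq (ultra_class (repr z)) (ultra_class (rp c)).
    by apply/cone_classP; rewrite ultra_reprK -cz reprE.
  move=> /(cone_eqE _ _ (esym (ultra_reprK nu))) /(_ _ e30).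
  by apply: filterS => n; apply: le_lt_trans; exact: ler_norm.
have ab : \forall n \near U, 0 < w n /\
    `|mdist (rp a n) (rp b n) / w n - cone_dist a b| < e / 3.
  by apply: filterI; [exact: scaling_pos|exact: cone_distP].
apply: filterS3 (eqv a x ax) (eqv b y by_) ab => n xa yb [w0].
rewrite !ltr_norml => /andP[l1 l2].
have tri (p1 p2 p3 : Y) : mdist p1 p3 / w n <= mdist p1 p2 / w n + mdist p2 p3 / w n.
  rewrite -mulrDl ler_wpM2r ?invr_ge0 ?(ltW w0)//; exact: metric_triangle.
have t1 := tri (repr x n) (rp a n) (repr y n).
have t2 := tri (rp a n) (rp b n) (repr y n).
have t3 := tri (rp a n) (repr x n) (rp b n).
have t4 := tri (repr x n) (repr y n) (rp b n).
rewrite (metric_sym (rp b n)) in t2; rewrite (metric_sym (rp a n) (repr x n)) in t3.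
by apply/andP; split; lra.
Qed.

Lemma cone_distxx a : cone_dist a a = 0.
Proof.
rewrite /cone_dist -(ultra_reprK (repr _)); apply: stdist_st => e e0.
by near=> n; rewrite mdistxx mul0r subrr normr0.
Unshelve. all: by end_near. Qed.

Lemma cone_dist_positivity a b : cone_dist a b = 0 -> a = b.
Proof.
move=> ab0; apply: val_inj; rewrite (reprE a) (reprE b).
apply/cone_classP/(cone_eqE _ _ (esym (ultra_reprK nu))) => e e0.
have := cone_distP a b e0; rewrite ab0.
by apply: filterS => n; rewrite subr0.
Qed.

Lemma cone_dist_sym a b : cone_dist a b = cone_dist b a.
Proof.
rewrite {1}/cone_dist -(ultra_reprK (repr (val a))) -(ultra_reprK (repr (val b))).
apply: stdist_st => e e0; apply: filterS (cone_distP b a e0) => n.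
by rewrite metric_sym.
Qed.

Lemma cone_dist_triangle b a c :
  cone_dist a c <= cone_dist a b + cone_dist b c.
Proof.
apply/ler_addgt0Pl => e e0; have e30 : 0 < e / 3 by rewrite divr_gt0.
have : \forall n \near U, 0 < w n /\
    (`|mdist (rp a n) (rp b n) / w n - cone_dist a b| < e / 3 /\
    (`|mdist (rp b n) (rp c n) / w n - cone_dist b c| < e / 3 /\
     `|mdist (rp a n) (rp c n) / w n - cone_dist a c| < e / 3)).
  apply: filterI; first exact: scaling_pos.
  by apply: filterI; [|apply: filterI]; exact: cone_distP.
move=> /filter_ex[n [w0]]; rewrite !ltr_norml => -[/andP[? ?] [/andP[? ?] /andP[? ?]]].
have : mdist (rp a n) (rp c n) / w n <=
    mdist (rp a n) (rp b n) / w n + mdist (rp b n) (rp c n) / w n.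
  rewrite -mulrDl ler_wpM2r ?invr_ge0 ?(ltW w0)//; exact: metric_triangle.
by move=> ?; lra.
Qed.

HB.instance Definition _ := @isMetric.Build R (asymptotic_cone nu_gg1)
  cone_dist cone_distxx cone_dist_positivity cone_dist_sym cone_dist_triangle.

End AsymptoticCone.
End Ultrapower.
Arguments ultrapower U {UU} T.

Section RealTrees.
Context {R : realType}.
Implicit Type X : metricType R.

Definition isometric X (Z : metricType R) :=
  exists2 f : X -> Z, bijective f &
    forall x y, mdist (f x) (f y) = mdist x y.

Definition is_asymptotic_cone (U : set_system nat) {UU : UltraFilter U} X :=
  exists (Y : metricType R) (q : ultrapower U Y) (nu : ultrapower U R)
    (nu_gg1 : hyper_gg nu (ultra_cst 1)),
    isometric X (asymptotic_cone q nu_gg1).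

(* A map defined on [0, l] is represented by a function on R, whose values
   outside of [0, l] are irrelevant. *)
Definition is_geodesic X (l : R) (g : R -> X) :=
  0 <= l /\ {in `[0, l] &, forall s t, mdist (g t) (g s) = `|t - s|}.

Definition geodesic_side X (x y : X) (S : set X) :=
  exists l (g : R -> X),
    [/\ is_geodesic l g, g 0 = x, g l = y & S = g @` `[0, l]].

Definition geodesic_space X := forall x y : X, exists S, geodesic_side x y S.

Definition geodesic_triangles_are_tripods X :=
  forall (x y z : X) (A B C : set X),
    geodesic_side x y A -> geodesic_side y z B -> geodesic_side z x C ->
    [/\ A `<=` B `|` C, B `<=` C `|` A & C `<=` A `|` B].

Definition complete_space X :=
  forall F : set_system X, ProperFilter F -> cauchy F -> exists x : X, F --> x.

Definition real_tree X :=
  [/\ complete_space X, geodesic_space X & geodesic_triangles_are_tripods X].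

Definition geodesics_extend X :=
  forall (l : R) (g : R -> X), 0 < l -> is_geodesic l g ->
    exists l' (g' : R -> X),
      [/\ l < l', is_geodesic l' g' & {in `[0, l], g' =1 g}].

(* The valency of X at p is the cardinality of this set. *)
Definition components_away X (p : X) : set (set X) :=
  connected_component [set~ p] @` [set~ p].

End RealTrees.
Arguments is_asymptotic_cone {R} U {UU} X.

(* Main.v *)
(** In a real tree, two points [x, y] other than [p] lie in different components
    of the complement of [p] exactly when [d(x, y) = d(x, p) + d(p, y)]. Since
    geodesics extend and the tree is complete, each component contains a point
    at distance [1] from [p]; infinitely many components thus give countably
    many points at distance [1] from [p] and [2] from each other. Index them by
    finite bit strings. By saturation the representing internal sequence keeps
    these distances, up to an infinitesimal after rescaling, for all bit strings
    of some infinite hyperfinite length [K]; truncating each set of naturals to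
    its first [K] bits yields [2^aleph_0] points of the cone with the same
    distances, hence that many components. *)
Require Import Defs.
From HB Require Import structures.
From mathcomp Require Import all_boot all_order all_algebra.
From mathcomp Require Import all_classical all_reals all_analysis.
From mathcomp Require Import lra.

Set Implicit Arguments.
Unset Strict Implicit.
Unset Printing Implicit Defensive.

Import Order.TTheory GRing.Theory Num.Theory.
Local Open Scope classical_set_scope.
Local Open Scope ring_scope.
Local Open Scope card_scope.

(** * Nonprincipal ultrafilters and saturation *)

Lemma nonprincipal_near_ge (U : set_system nat) (UU : UltraFilter U) :
  (forall n, U <> principal_filter n) ->
  forall k, \forall n \near U, (k <= n)%N.
Proof.
move=> Unp; elim=> [|k IH]; first exact: nearW.
suff nk : \forall n \near U, n <> k.
  by apply: filterS2 IH nk => n kn /eqP nk; rewrite ltn_neqAle eq_sym nk.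
have [Uk|//] := in_ultra_setVsetC [set k] UU.
exfalso; apply: (Unp k); apply/seteqP; split => A.
- move=> UA; apply/principal_filterP.
  by have [n [/= -> //]] := filter_ex (filterI Uk UA).
- by move=> /principal_filterP Ak; apply: filterS Uk => n ->.
Qed.

(* Countable saturation of the ultrapower: [K] is an infinite hypernatural at
   which the internal properties [P k] still hold. *)
Lemma ultra_overspill (U : set_system nat) (UU : UltraFilter U)
    (P : nat -> nat -> Prop) :
  (forall n, U <> principal_filter n) ->
  (forall k, \forall n \near U, P k n) ->
  exists K : nat -> nat, (\forall n \near U, P (K n) n) /\
    forall k, \forall n \near U, (k <= K n)%N.
Proof.
move=> Unp PU.
(* [K n] is the largest [k <= n] with [P k n], or [0] if there is none. The cutoff [k <= n] makes
   the maximum exist and, [U] being nonprincipal, excludes no fixed [k] for almost all [n]. *)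
have KP n : exists K : nat, forall k, (k <= n)%N -> P k n -> (k <= K)%N /\ P K n.
  have [[k kn Pk]|noP] := pselect (exists2 k, (k <= n)%N & P k n); last first.
    by exists 0%N => k kn Pk; exfalso; apply: noP; exists k.
  have exK : exists k, `[< (k <= n)%N /\ P k n >] by exists k; apply/asboolP.
  have ubK k' : `[< (k' <= n)%N /\ P k' n >] -> (k' <= n)%N by move=> /asboolP[].
  have [K /asboolP[_ PK] Kmax] := ex_maxnP exK ubK.
  by exists K => k' k'n Pk'; split=> //; apply: Kmax; apply/asboolP.
have [K {}KP] := choice KP; exists K; split.
  by apply: filterS (PU 0%N) => n /(KP n _ (leq0n _))[].
move=> k; apply: filterS2 (PU k) (nonprincipal_near_ge UU Unp k) => n Pk kn.
by have [] := KP n k kn Pk.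
Qed.

(** * Sequences representing points of the cone *)

Section Cone.
Context (R : realType) (U : set_system nat) (UU : UltraFilter U)
  (Y : metricType R) (q : ultrapower U Y) (nu : ultrapower U R)
  (nu_gg1 : hyper_gg nu (ultra_cst 1)).
Local Notation cone := (asymptotic_cone q nu_gg1).

Definition scaled_dist (u v : nat -> Y) (n : nat) : R :=
  mdist (u n) (v n) / repr nu n.

Definition cone_finite (u v : nat -> Y) :=
  exists r : R, \forall n \near U, scaled_dist u v n <= r.

Lemma cone_finite_sym u v : cone_finite u v -> cone_finite v u.
Proof.
by move=> [r h]; exists r; apply: filterS h => n; rewrite /scaled_dist metric_sym.
Qed.

Lemma cone_finite_trans u v t :
  cone_finite u v -> cone_finite v t -> cone_finite u t.
Proof.
move=> [r1 h1] [r2 h2]; exists (r1 + r2).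
apply: filterS3 (scaling_pos nu_gg1) h1 h2 => n w0 h1 h2.
rewrite (le_trans _ (lerD h1 h2))// -mulrDl ler_wpM2r ?invr_ge0 ?(ltW w0)//.
exact: metric_triangle.
Qed.

Lemma cone_finiteE u v :
  hyper_bigO (ultra_dist (ultra_class u) (ultra_class v)) nu <->
  cone_finite u v.
Proof.
rewrite -{1}(ultra_reprK nu) /hyper_bigO /ultra_dist /hyper_div !ultra_map2E.
rewrite hyper_finiteE; split=> -[r h]; exists r;
  apply: filterS2 (scaling_pos nu_gg1) h => n w0;
  by rewrite /scaled_dist ger0_norm// divr_ge0 ?mdist_ge0// ltW.
Qed.

Definition represents (u : nat -> Y) (a : cone) :=
  val a = cone_class nu (ultra_class u) /\ cone_finite u (repr q).

Lemma represents_ex (a : cone) : exists u, represents u a.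
Proof.
have /asboolP[x ax xq] := valP a.
exists (repr x); split; first by rewrite ultra_reprK.
by apply/cone_finiteE; rewrite !ultra_reprK.
Qed.

Lemma ex_represents u : cone_finite u (repr q) -> exists a, represents u a.
Proof.
move=> uq.
have aP : `[< exists2 x, cone_class nu (ultra_class u) = cone_class nu x &
    hyper_bigO (ultra_dist x q) nu >].
  apply/asboolP; exists (ultra_class u) => //.
  by rewrite -(ultra_reprK q); apply/cone_finiteE.
exists (exist (fun c => `[< exists2 x, c = cone_class nu x &
    hyper_bigO (ultra_dist x q) nu >]) (cone_class nu (ultra_class u)) aP).
by [].
Qed.

(** Exact distances in the cone become approximations valid for [U]-almost all [n], the form to
    which overspill applies; the converse is uniqueness of the standard part. *)
Lemma mdist_coneE a b u v (r : R) : represents u a -> represents v b ->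
  mdist a b = r <->
  forall e : R, 0 < e -> \forall n \near U, `|scaled_dist u v n - r| < e.
Proof.
move=> [au uq] [bv vq].
have /cone_finiteE : cone_finite u v.
  exact/(cone_finite_trans uq)/cone_finite_sym.
rewrite [mdist a b](cone_distE au bv) => /stP; set s := st _ => sP.
have E t : infinitesimal (hyper_sub (hyper_div (ultra_dist (ultra_class u)
    (ultra_class v)) nu) (ultra_cst t)) <->
    forall e : R, 0 < e -> \forall n \near U, `|scaled_dist u v n - t| < e.
  rewrite -{1}(ultra_reprK nu) /ultra_dist /hyper_div !ultra_map2E.
  exact: st_subproof.
by split=> [<-|/E/st_unique//]; apply/E.
Qed.

Lemma cone_equidistant (p : cone) (x : seq bool -> cone) (r s : R) :
  (forall n, U <> principal_filter n) ->
  (forall b, mdist (x b) p = r) ->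
  (forall b b', b != b' -> mdist (x b) (x b') = s) ->
  exists y : set nat -> cone, (forall S, mdist (y S) p = r) /\
    forall S S', S <> S' -> mdist (y S) (y S') = s.
Proof.
move=> Unp xp xx.
have [pn pnP] := represents_ex p.
have [xn xnP] := choice (fun b => represents_ex (x b)).
(* [k] is both the length of the strings and the precision, so an infinite [K] leaves only
   infinitesimal errors. For fixed [k] there are finitely many conditions, hence [filter_forall]. *)
pose P k n :=
  (forall b : k.-tuple bool, `|scaled_dist (xn b) pn n - r| < k.+1%:R^-1) /\
  (forall b b' : k.-tuple bool, b != b' ->
     `|scaled_dist (xn b) (xn b') n - s| < k.+1%:R^-1).
have PU k : \forall n \near U, P k n.
  apply: filterI; apply: filter_forall => b.
    by apply: (mdist_coneE _ (xnP b) pnP).1 => //; rewrite invr_gt0.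
  apply: filter_forall => b'; have [->|bb'] := eqVneq b b'; first exact: nearW.
  have : \forall n \near U, `|scaled_dist (xn b) (xn b') n - s| < k.+1%:R^-1.
    apply: (mdist_coneE _ (xnP b) (xnP b')).1; first exact: xx.
    by rewrite invr_gt0.
  by apply: filterS.
have [K [KP Koo]] := ultra_overspill UU Unp PU.
pose code (S : set nat) k := [tuple `[< S (val i) >] | i < k].
pose yn S n := xn (code S (K n)) n.
have small (e : R) : 0 < e -> \forall n \near U, (K n).+1%:R^-1 < e.
  move=> e0; have := Koo (Num.trunc e^-1); apply: filterS => n.
  rewrite -ltnS => nK; rewrite invf_plt ?posrE//.
  apply: (lt_le_trans (truncnS_gt _)); by rewrite ler_nat.
have ypn S (e : R) : 0 < e ->
    \forall n \near U, `|scaled_dist (yn S) pn n - r| < e.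
  move=> e0; apply: filterS2 KP (small e e0) => n [+ _] Ke.
  by move=> /(_ (code S (K n)))/lt_trans; apply.
have yq S : cone_finite (yn S) (repr q).
  apply: (@cone_finite_trans _ pn); last exact: pnP.2.
  exists (r + 1); apply: filterS (ypn S 1 ltr01) => n.
  by rewrite ltr_norml => /andP[_ ?]; lra.
have [y yP] := choice (fun S => ex_represents (yq S)).
exists y; split=> [S|S S' SS'].
  exact: (mdist_coneE _ (yP S) pnP).2 (ypn S).
apply: (mdist_coneE _ (yP S) (yP S')).2 => e e0.
have [m Sm] : exists m, `[< S m >] != `[< S' m >].
  apply: contrapT => noex; apply: SS'; apply/funext => m; apply/propext.
  apply: contrapT => Sm; apply: noex; exists m.
  by apply/eqP => eqSm; apply: Sm; exact: asbool_eq_equiv eqSm.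
(* [S] and [S'] disagree at [m], so their codes differ as soon as [m < K n]. *)
apply: filterS3 KP (small e e0) (Koo m.+1) => n [_ KP] Ke mK.
apply: lt_trans Ke; apply: KP; apply: contra Sm => /eqP.
by move=> /(congr1 (fun t => tnth t (Ordinal mK))); rewrite !tnth_mktuple => /eqP.
Qed.

End Cone.

(** * Betweenness and geodesics *)

Section Tree.
Context (R : realType) (X : metricType R).
Implicit Types (x y z p : X).

(* In a geodesic space in which triangles are tripods, this says that [p] lies
   on the geodesic from [x] to [y]. *)
Definition between x p y := mdist x y = mdist x p + mdist p y.

Lemma between_sym x p y : between x p y -> between y p x.
Proof.
by rewrite /between metric_sym => ->; rewrite addrC metric_sym (metric_sym x).
Qed.

(** With the next two lemmas this makes [between p] a partial order, to be thought of as the order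
    of the tree rooted at [p]; Zorn's lemma will be applied to it. *)
Lemma between_refl p x : between p x x.
Proof. by rewrite /between mdistxx addr0. Qed.

Lemma between_trans p x y z : between p x y -> between p y z -> between p x z.
Proof.
rewrite /between => xy yz.
have := metric_triangle p x z; have := metric_triangle x y z; lra.
Qed.

Lemma between_anti p x y : between p x y -> between p y x -> x = y.
Proof.
rewrite /between (metric_sym y x) => xy yx; apply: mdist_positivity; lra.
Qed.

Lemma between_not_opposite p x y : x <> p -> between p x y -> ~ between x p y.
Proof.
rewrite /between (metric_sym p x) => xp xy yx.
by apply/xp/mdist_positivity; lra.
Qed.

Lemma geodesic_side_between x y S p :
  geodesic_side x y S -> S p -> between x p y.
Proof.
move=> [l [g [[l0 gd] <- <- ->]]] [t /= t0l <-].
have t01 := t0l; rewrite /= in_itv/= in t01; case/andP: t01 => t0 tl.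
have i0 : 0 \in `[0, l] by rewrite in_itv/= lexx.
have il : l \in `[0, l] by rewrite in_itv/= lexx l0.
rewrite /between !gd// !sub0r !normrN (distrC t) !ger0_norm ?subr_ge0//; lra.
Qed.

Lemma geodesic_side_ends x y S : geodesic_side x y S -> S x /\ S y.
Proof.
move=> [l [g [[l0 _] <- <- ->]]].
by split; [exists 0|exists l]; rewrite //= in_itv/= lexx ?l0.
Qed.

Lemma geodesic_side_connected x y S : geodesic_side x y S -> connected S.
Proof.
move=> [l [g [[l0 gd] _ _ ->]]].
apply: connected_continuous_connected; first exact: segment_connected.
apply/subspace_continuousP => s sl.
apply/metricType_numDomainType.cvgrPdist_lt => e e0.
rewrite near_withinE; apply/nbhs_ballP; exists e => // t st tl.
by rewrite gd// distrC.
Qed.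

Lemma open_mdist_lt (a b : X) (c : R) :
  open [set z | mdist z a < mdist z b + c].
Proof.
rewrite openE => z /= zab; apply/metricType_numDomainType.nbhs_mdistP.
exists ((mdist z b + c - mdist z a) / 2); first by rewrite /= divr_gt0// subr_gt0.
move=> w /= zw.
have := metric_triangle w z a; have := metric_triangle z w b.
rewrite (metric_sym w z); lra.
Qed.

(** * Completeness and extension to a prescribed distance *)

(** Distances to [p] increase along the chain and are bounded, so the tail past a point of nearly
    supremal distance is small. The filter of tails is thus Cauchy, and betweenness passes to its
    limit. *)
Lemma chain_upper_bound (p : X) (L : R) (A : set X) :
  complete_space X -> A !=set0 -> total_on A (between p) ->
  (forall x, A x -> mdist p x <= L) ->
  exists t, (forall x, A x -> between p x t) /\ mdist p t <= L.
Proof.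
move=> cX [a Aa] Atot AL.
pose B x := A `&` between p x.
have FF : Filter (filter_from A B).
  apply: filter_from_filter; first by exists a.
  move=> x y Ax Ay; have [xy|yx] := Atot x y Ax Ay.
  - exists y => // z [Az yz]; split; split => //; exact: between_trans xy yz.
  - exists x => // z [Az xz]; split; split => //; exact: between_trans yx xz.
have PF : ProperFilter (filter_from A B).
  by apply: filter_from_proper => x Ax; exists x; split=> //; exact: between_refl.
have supA : has_sup (mdist p @` A).
  by split; [exists (mdist p a), a|exists L => _ [x Ax <-]; exact: AL].
have cF : cauchy (filter_from A B).
  apply: cauchy_exP => e e0; have [_ [x Ax <-] xe] := sup_adherent e0 supA.
  exists x, x => // y [Ay xy]; rewrite ballEmdist/=.
  have : mdist p y <= sup (mdist p @` A).
    by apply: ub_le_sup; [exact: supA.2|exists y].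
  by move: xy xe; rewrite /between; lra.
have [t Ft] := cX _ PF cF.
have near_t x (e : R) : A x -> 0 < e ->
    exists y, [/\ A y, between p x y & mdist t y < e].
  move=> Ax e0.
  have /metricType_numDomainType.fcvgrPdist_lt/(_ e e0) te := Ft.
  have Bx : filter_from A B (B x) by exists x.
  by have [y [/= ? [? ?]]] := filter_ex (filterI te Bx); exists y.
exists t; split=> [x Ax|]; last first.
  apply/ler_addgt0Pl => e e0; have [y [Ay _ ty]] := near_t a e Aa e0.
  have := metric_triangle p y t; rewrite (metric_sym y t).
  by have := AL y Ay; lra.
apply/eqP; rewrite eq_le metric_triangle/=; apply/ler_addgt0Pl => e e0.
have [|y [Ay xy ty]] := near_t x (e / 2) Ax; first by rewrite divr_gt0.
have := metric_triangle x y t; have := metric_triangle p t y.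
by move: xy; rewrite /between (metric_sym y t); lra.
Qed.

Lemma geodesic_point (p x : X) (r : R) :
  geodesic_space X -> 0 <= r <= mdist p x ->
  exists2 y, mdist p y = r & between p y x.
Proof.
move=> gX /andP[r0 rx]; have [S Sx] := gX p x.
have [l [g [[l0 gd] gp gx SE]]] := Sx.
have i0 : 0 \in `[0, l] by rewrite in_itv/= lexx.
have il : l \in `[0, l] by rewrite in_itv/= lexx l0.
have lE : mdist p x = l by rewrite -gp -gx gd// sub0r normrN ger0_norm.
have ir : r \in `[0, l] by rewrite in_itv/= r0 -lE.
exists (g r); first by rewrite -gp gd// sub0r normrN ger0_norm.
by apply: geodesic_side_between Sx _; rewrite SE; exists r.
Qed.

Lemma extension_step (p x : X) (L : R) :
  geodesic_space X -> geodesics_extend X -> x <> p -> mdist p x < L ->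
  exists y, [/\ y <> x, between p x y & mdist p y <= L].
Proof.
move=> gX eX xp xL; have [S [l [g [[l0 gd] gp gx _]]]] := gX p x.
have i0 : 0 \in `[0, l] by rewrite in_itv/= lexx.
have il : l \in `[0, l] by rewrite in_itv/= lexx l0.
have lE : mdist p x = l by rewrite -gp -gx gd// sub0r normrN ger0_norm.
have lgt0 : 0 < l by rewrite -lE mdist_gt0; apply/eqP => /esym.
have [l' [g' [ll' [l'0 g'd] g'g]]] := eX l g lgt0 (conj l0 gd).
(* The prolonged geodesic is stopped at distance [L]; both [l'] and [L] exceed [l], so something is
   still gained. *)
pose t := Num.min l' L.
have lt : l < t by rewrite lt_min ll' -lE.
have tl' : t <= l' by rewrite ge_min lexx.
have i'0 : 0 \in `[0, l'] by rewrite in_itv/= lexx.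
have i'l : l \in `[0, l'] by rewrite in_itv/= l0 ltW.
have i't : t \in `[0, l'] by rewrite in_itv/= tl' (le_trans l0 (ltW lt)).
have pt : mdist p (g' t) = t.
  by rewrite -gp -g'g// g'd// sub0r normrN ger0_norm// (le_trans l0 (ltW lt)).
exists (g' t); split.
- by move=> E; move: lt; rewrite -pt E lE ltxx.
- rewrite /between pt lE -gx -g'g// g'd// distrC ger0_norm ?subr_ge0 ?ltW//; lra.
- by rewrite pt ge_min lexx orbT.
Qed.

(** A single extension may gain arbitrarily little, so Zorn's lemma replaces iteration: a maximal
    point nearer to [p] than [L] could be extended once more. *)
Lemma extend_to_distance (p x : X) (L : R) :
  complete_space X -> geodesic_space X -> geodesics_extend X ->
  x <> p -> mdist p x <= L ->
  exists2 y, between p x y & mdist p y = L.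
Proof.
move=> cX gX eX xp xL.
pose T := {y : X | between p x y /\ mdist p y <= L}.
have x0 : T by exists x; split => //; exact: between_refl.
pose le (s t : T) := `[< between p (sval s) (sval t) >].
have [||||[m [xm mL]] mmax] := @Zorn T le.
- by move=> s; apply/asboolP; exact: between_refl.
- by move=> r s t /asboolP rs /asboolP st; apply/asboolP; exact: between_trans st.
- move=> [s Ps] [t Pt] /asboolP/= st /asboolP/= ts.
  by apply: eq_exist; exact: between_anti st ts.
- move=> A Atot; have [A0|A0] := pselect (A !=set0); last first.
    by exists x0 => s As; exfalso; apply: A0; exists s.
  have [s As] := A0.
  have [||_ [y Ay <-]|t [At tL]] := @chain_upper_bound p L (sval @` A) cX.
  + by exists (sval s), s.
  + move=> _ _ [u Au <-] [v Av <-].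
    by have [/asboolP|/asboolP] := Atot u v Au Av; [left|right].
  + by have [] := svalP y.
  have xt : between p x t.
    by apply: between_trans (At _ _); [exact: (svalP s).1|exists s].
  by exists (exist _ t (conj xt tL)) => y Ay; apply/asboolP; apply: At; exists y.
exists m => //; apply/eqP; rewrite eq_le mL/= leNgt; apply/negP => mltL.
have mp : m <> p.
  move=> mE; have := xm; rewrite mE /between mdistxx => x0E.
  have := mdist_ge0 p x; have := mdist_ge0 x p => ? ?.
  by apply/xp/mdist_positivity; lra.
have [y [ym my yL]] := extension_step gX eX mp mltL.
have := mmax (exist _ y (conj (between_trans xm my) yL)) (asboolT my).
by move=> /(congr1 sval).
Qed.

(** Extend beyond [x] if it is too near, go back along the geodesic if it is too far. The negated
    betweenness will mean that [y] is in the component of [x]. *)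
Lemma same_direction_at_distance (p x : X) (L : R) :
  complete_space X -> geodesic_space X -> geodesics_extend X ->
  x <> p -> 0 < L ->
  exists2 y, mdist p y = L & ~ between x p y.
Proof.
move=> cX gX eX xp L0; have [xL|Lx] := leP (mdist p x) L.
  have [y xy yL] := extend_to_distance cX gX eX xp xL.
  by exists y => //; exact: between_not_opposite.
have [|y yL yx] := @geodesic_point p x L gX; first by rewrite !ltW.
exists y => // /between_sym; apply: between_not_opposite => // yp.
by move: L0; rewrite -yL yp mdistxx ltxx.
Qed.

(** * Components of the complement of a point *)

(** The point [p'] of [S] at distance [mdist x p] from [x] lies on a side from [y] to [p] or from
    [p] to [x], and either case forces [p' = p]. *)
Lemma between_geodesic_side (x p y : X) (S : set X) :
  real_tree X -> geodesic_side x y S -> between x p y -> S p.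
Proof.
move=> [_ gX tX] Sxy xpy; have [l [g [[l0 gd] gx gy SE]]] := Sxy.
have [B Byp] := gX y p; have [C Cpx] := gX p x.
have i0 : 0 \in `[0, l] by rewrite in_itv/= lexx.
have il : l \in `[0, l] by rewrite in_itv/= lexx l0.
have lE : mdist x y = l by rewrite -gx -gy gd// sub0r normrN ger0_norm.
have pl : mdist x p \in `[0, l].
  by rewrite in_itv/= mdist_ge0/= -lE xpy lerDl mdist_ge0.
pose p' := g (mdist x p).
have xp' : mdist x p' = mdist x p.
  by rewrite -{1}gx gd// sub0r normrN ger0_norm// mdist_ge0.
have Sp' : S p' by rewrite SE; exists (mdist x p).
have xp'y := geodesic_side_between Sxy Sp'.
suff -> : p = p' by [].
have [SBC _ _] := tX _ _ _ _ _ _ Sxy Byp Cpx.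
apply/esym/mdist_positivity.
have [Bp'|Cp'] := SBC _ Sp'.
- have := geodesic_side_between Byp Bp'; move: xpy xp'y; rewrite /between.
  by rewrite (metric_sym y p') (metric_sym y p); lra.
- have := geodesic_side_between Cpx Cp'; rewrite /between.
  by rewrite (metric_sym p' x) (metric_sym p x) (metric_sym p' p); lra.
Qed.

(** In the triangle [z], [x], [w], the point [p] lies on a side at [w]; on the side from [w] to [z]
    it would be no farther from [z] than [w] is. *)
Lemma between_near (p x z w : X) :
  real_tree X -> between z p x -> mdist z w < mdist z p -> between w p x.
Proof.
move=> treeX zpx zw; have [_ gX tX] := treeX.
have [A Azx] := gX z x; have [B Bxw] := gX x w; have [C Cwz] := gX w z.
have Ap := between_geodesic_side treeX Azx zpx.
have [ABC _ _] := tX _ _ _ _ _ _ Azx Bxw Cwz.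
have [Bp|Cp] := ABC p Ap.
  exact/between_sym/(geodesic_side_between Bxw).
have := geodesic_side_between Cwz Cp; rewrite /between.
by have := mdist_ge0 w p; rewrite (metric_sym w z) (metric_sym p z); lra.
Qed.

Lemma connected_component_tree (p x y : X) :
  real_tree X -> x <> p -> y <> p ->
  connected_component [set~ p] x y <-> ~ between x p y.
Proof.
move=> treeX xp yp; have [_ gX _] := treeX; split; last first.
  move=> nxy; have [S Sxy] := gX x y; have [Sx Sy] := geodesic_side_ends Sxy.
  apply: (connected_component_max Sx _ (geodesic_side_connected Sxy) Sy).
  by move=> z Sz zp; apply: nxy; apply: geodesic_side_between Sxy _; rewrite -zp.
move=> xy xpy; set K := connected_component [set~ p] x in xy.
have Kp z : K z -> z <> p by move=> /connected_component_sub.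
(* [K] is split by the open set of points on the side of [x] and the open set
   of points separated from [x] by [p]. *)
pose O1 := [set z | mdist z x < mdist z p + mdist p x].
pose O2 := [set z | z <> p /\ between z p x].
have oO1 : open O1 by exact: open_mdist_lt.
have oO2 : open O2.
  rewrite openE => z [zp zpx]; apply/metricType_numDomainType.nbhs_mdistP.
  exists (mdist z p) => [|w /= zw]; first by rewrite /= mdist_gt0; exact/eqP.
  split; last exact: between_near zw.
  by move=> wp; move: zw; rewrite wp ltxx.
have O12 : K `&` O1 = K `&` ~` O2.
  apply/seteqP; split=> z [Kz]; rewrite /O1 /O2 /between/= => zO; split => //=.
    by move=> [_ zE]; move: zO; rewrite zE ltxx.
  rewrite lt_neqAle metric_triangle andbT; apply/eqP => zE.
  by apply: zO; split => //; exact: Kp.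
have Kx : K x by exact: connected_component_refl.
(* The part of [K] in [O1] contains [x] and, by [O12], is open and closed in the connected set [K],
   so it is all of [K]; but [y] is not in [O1]. *)
have KE : K `&` O1 = K.
  apply: (@component_connected _ [set~ p] x).
  - exists x; split => //; rewrite /O1/= mdistxx addr_gt0// mdist_gt0.
      exact/eqP.
    by apply/eqP => /esym.
  - by exists O1.
  - by exists (~` O2) => //; exact: open_closedC.
have : K y by [].
rewrite -KE => -[_]; rewrite /O1/= => yO1.
by have := between_sym xpy; rewrite /between; lra.
Qed.

End Tree.

(** * From infinitely many components to continuum many *)

Theorem corollary5p5 (R : realType)
    (U : set_system nat) (UU : UltraFilter U)
    (U_nonprincipal : forall n : nat, U <> principal_filter n)
    (X : metricType R) :
  real_tree X -> geodesics_extend X -> is_asymptotic_cone U X ->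
  forall p : X, infinite_set (components_away p) ->
    [set: set nat] #<= components_away p.
Proof.
move=> treeX eX [Y [q [nu [nu_gg1 [f fbij fd]]]]] p.
have [cX gX _] := treeX.
move=> /infiniteP/pcard_leP[h].
have hx n : exists x, x <> p /\ connected_component [set~ p] x = h n.
  by have [x xp xh] := 'funS_h (I : [set: nat] n); exists x.
have [x {}hx] := choice hx.
have hy n : exists y, mdist p y = 1 /\ ~ between (x n) p y.
  have [y py xpy] := same_direction_at_distance cX gX eX (hx n).1 (@ltr01 R).
  by exists y.
have [y yP] := choice hy.
have away z : mdist p z = 1 -> z <> p.
  by move=> pz zp; move: pz; rewrite zp mdistxx => /eqP; rewrite eq_sym oner_eq0.
have yh n : connected_component [set~ p] (y n) = h n.
  have [xp <-] := hx n; have [py xpy] := yP n.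
  by apply/esym/same_connected_component/(connected_component_tree treeX xp (away _ py)).
(* Distinct components put [p] between the two points, so their distance is [1 + 1]. *)
have yy n m : n <> m -> mdist (y n) (y m) = 2.
  move=> nm; have [yn _] := yP n; have [ym _] := yP m.
  suff : between (y n) p (y m) by rewrite /between metric_sym (metric_sym _ p); lra.
  apply: contrapT => /(connected_component_tree treeX (away _ yn) (away _ ym)).
  move=> /same_connected_component; rewrite !yh => hnm.
  by apply: nm; apply: inj hnm; rewrite inE.
have [g gK fK] := fbij.
(* [pickle] numbers the bit strings injectively, so distinct strings get points in distinct
   components. *)
have [||z [zp zz]] := @cone_equidistant R U UU Y q nu nu_gg1 (f p)
    (f \o y \o pickle) 1 2 U_nonprincipal.
- by move=> b /=; rewrite fd metric_sym; exact: (yP _).1.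
- by move=> b b' bb' /=; rewrite fd yy// => /(pcan_inj pickleK)/eqP; exact/negP.
have zp' S : mdist p (g (z S)) = 1 by rewrite metric_sym -fd fK.
apply/pcard_leP/injfunPex; exists (connected_component [set~ p] \o g \o z).
  by move=> S _; exists (g (z S)) => //; exact: away.
(* For [S <> S'] the distances [1], [1], [2] put [p] between the two points, which a common
   component excludes. *)
move=> S S' _ _ /= zSS'; apply: contrapT => SS'.
have : connected_component [set~ p] (g (z S)) (g (z S')).
  by rewrite zSS'; apply: connected_component_refl; exact: away.
move=> /(connected_component_tree treeX (away _ (zp' S)) (away _ (zp' S'))); apply.
have := zz S S' SS'; rewrite /between -fd !fK => ->.
by have := zp' S; have := zp' S'; rewrite (metric_sym _ p); lra.
Qed.
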